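(* Let $\mathcal{G}$ be a directed graph without self-loops, with vertices $v_1,\dots,v_k$ and edges $e_1,\dots,e_\ell$, and let $A_1,\dots,A_k$ be real $n\times n$ matrices. Suppose there exist invertible matrices $P_1,\dots,P_k$ and Jordan matrices $J_1,\dots,J_k$ with $A_i=P_iJ_iP_i^{-1}$ a Jordan decomposition of $A_i$ for $i=1,\dots,k$, such that for each edge $(r,s)\in\mathcal{E}(\mathcal{G})$ there exists $\eta_{(r,s)}>0$ with $$\Vert P_{(r,s)}e^{\eta_{(r,s)}J_r}\Vert<1,\qquad P_{(r,s)}:=P_s^{-1}P_r.$$ Then there exist open intervals $I_1,\dots,I_\ell\subseteq(0,\infty)$, with $\eta_{(r,s)}\in I_i$ whenever $e_i=(r,s)$, such that the switched system $x'(t)=A_{\sigma(t)}x(t)$, $t\geq 0$, is globally exponentially stable for every switching signal $\sigma\in\mathcal{S}_\mathcal{G}(I_1,\dots,I_\ell)$ that has infinitely many switching times $t_n$ with $t_n\to\infty$.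
   Context: $\mathcal{E}(\mathcal{G})$ is the set of ordered pairs $(i,j)$ such that there is an edge from $v_i$ to $v_j$. A $\mathcal{G}$-admissible signal is a piecewise constant right-continuous function $\sigma:[0,\infty)\to\{1,\dots,k\}$ with discontinuities (switching times) $0=t_0<t_1<t_2<\cdots$ such that, writing $\sigma_i$ for the value of $\sigma$ on $[t_{i-1},t_i)$, we have $(\sigma_i,\sigma_{i+1})\in\mathcal{E}(\mathcal{G})$ for all $i\geq1$; the set of such signals is $\mathcal{S}_\mathcal{G}$. The time spent on the edge $(\sigma_i,\sigma_{i+1})$ at the $i$-th switch is $t_i-t_{i-1}$ (the time spent in subsystem $\sigma_i$ before switching to $\sigma_{i+1}$). For open intervals $I_1,\dots,I_\ell\subseteq(0,\infty)$, $\mathcal{S}_\mathcal{G}(I_1,\dots,I_\ell)$ is the set of $\sigma\in\mathcal{S}_\mathcal{G}$ such that every time spent on edge $e_i$ lies in $I_i$, for each $i$. $\Vert\cdot\Vert$ is the spectral norm. The switched system is globally exponentially stable if there exist $\alpha,\beta>0$ such that every solution satisfies $\Vert x(t)\Vert\leq\alpha e^{-\beta t}\Vert x(0)\Vert$ for all $t\geq0$. *)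

(* Defs.v *)
From mathcomp Require Import all_boot all_order all_algebra.
From mathcomp Require Import all_classical all_reals all_analysis.
From mathcomp Require Import complex.
Import Order.TTheory GRing.Theory Num.Theory.
Import numFieldNormedType.Exports.

Set Implicit Arguments.
Unset Strict Implicit.
Unset Printing Implicit Defensive.

Local Open Scope ring_scope.
Local Open Scope classical_set_scope.

Section SwitchedDefs.
Variable R : realType.
Local Notation C := (complex R).

Definition cabs2 (z : C) : R := complex.Re z ^+ 2 + complex.Im z ^+ 2.
Definition cabs (z : C) : R := Num.sqrt (cabs2 z).

Definition cvnorm n (v : 'cV[C]_n) : R := Num.sqrt (\sum_i cabs2 (v i 0)).
Definition rvnorm n (v : 'cV[R]_n) : R := Num.sqrt (\sum_i (v i 0) ^+ 2).

Definition spec_norm n (M : 'M[C]_n) : R :=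
  sup [set cvnorm (M *m v) | v in [set v : 'cV[C]_n | cvnorm v <= 1]].

Definition exp_partial n (M : 'M[C]_n) (N : nat) : 'M[C]_n :=
  \sum_(j < N) ((j`!)%:R)^-1 *: M ^+ j.

Definition is_expm n (M E : 'M[C]_n) : Prop :=
  forall (i j : 'I_n) (eps : R), 0 < eps ->
    exists N0 : nat, forall N : nat, (N0 <= N)%N ->
      cabs (exp_partial M N i j - E i j) < eps.

Definition expm n (M : 'M[C]_n) : 'M[C]_n := xget 0 [set E | is_expm M E].

(** Jordan matrix: block diagonal with Jordan blocks; equivalently upper
    bidiagonal, superdiagonal entries in {0,1}, and a superdiagonal 1 only
    between equal diagonal entries. *)
Definition is_jordan n (J : 'M[C]_n) : Prop :=
  forall i j : 'I_n,
    [/\ (i : nat) != j -> (j : nat) != i.+1 -> J i j = 0,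
        (j : nat) = i.+1 -> J i j = 0 \/ J i j = 1
      & (j : nat) = i.+1 -> J i j = 1 -> J i i = J j j].

Definition digraph_no_loops k l (e : 'I_l -> 'I_k * 'I_k) : Prop :=
  injective e /\ forall i, (e i).1 != (e i).2.

Definition signal_in k l (e : 'I_l -> 'I_k * 'I_k) (a b : 'I_l -> R)
    (sigma : R -> 'I_k) (t : nat -> R) : Prop :=
  [/\ t 0%N = 0,
      (forall m, t m < t m.+1),
      (forall M : R, exists m, M < t m),
      (forall m (s : R), t m <= s -> s < t m.+1 -> sigma s = sigma (t m))
    & (forall m, exists i, e i = (sigma (t m), sigma (t m.+1)) /\
                           a i < t m.+1 - t m < b i)].

Definition is_solution n k (A : 'I_k -> 'M[R]_n) (sigma : R -> 'I_k)
    (t : nat -> R) (x : R -> 'cV[R]_n) : Prop :=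
  {within [set s : R | 0 <= s], continuous x} /\
  forall s : R, 0 < s -> (forall m, s != t m) ->
    derivable x s 1 /\ 'D_1 x s = A (sigma s) *m x s.

Definition GES n k (A : 'I_k -> 'M[R]_n) (sigma : R -> 'I_k)
    (t : nat -> R) : Prop :=
  exists alpha beta : R, 0 < alpha /\ 0 < beta /\
    forall x : R -> 'cV[R]_n, is_solution A sigma t x ->
      forall s : R, 0 <= s ->
        rvnorm (x s) <= alpha * expR (- (beta * s)) * rvnorm (x 0).

End SwitchedDefs.

(* Main.v *)
(* Measure the state of mode r in the coordinates z = P_r^-1 x.  Over a dwell
   time tau in mode r followed by a switch to mode s, z is multiplied by
   P_s^-1 P_r e^(tau J_r), whose spectral norm is below 1 at tau = eta and
   depends continuously on tau.  With finitely many edges, one rho < 1 bounds the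
   contraction at every switch when each tau stays in a small interval around
   eta; these intervals being bounded, the number of switches up to time s grows
   at least linearly in s, which yields exponential decay.

   The exponential is handled through its partial sums only: on a mode interval,
   Picard iteration shows that the Taylor sums applied to the initial state
   converge to the solution, and the sums at tau and eta differ, uniformly in
   their length, by at most a multiple of |e^(tau K) - e^(eta K)|, where K is the
   entrywise l^1 norm of J_r. *)
Require Import Defs.
From mathcomp Require Import all_boot all_order all_algebra.
From mathcomp Require Import all_classical all_reals all_analysis.
From mathcomp Require Import complex.
From mathcomp Require Import ring lra.
Import Order.TTheory GRing.Theory Num.Theory.
Import numFieldNormedType.Exports.
Local Open Scope ring_scope.

Set Implicit Arguments.
Unset Strict Implicit.
Unset Printing Implicit Defensive.

(** * Complex modulus, entrywise, Euclidean and spectral norms *)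

Section ComplexNorms.
Variable R : realType.
Local Notation C := (complex R).

(** Gives access to the norm of the numeric field [C]: the laws of [cabs] are pulled back along the
    injection [real_complex]. *)
Lemma cabs_normr (z : C) : `|z| = real_complex R (cabs z).
Proof. exact: normc_def. Qed.

Lemma cabs_ge0 (z : C) : 0 <= cabs z.
Proof. exact: sqrtr_ge0. Qed.

Lemma cabs0 : cabs (0 : C) = 0.
Proof. by apply: (@complexI R); rewrite -cabs_normr normr0. Qed.

Lemma cabs0_eq0 (z : C) : cabs z = 0 -> z = 0.
Proof. by move=> z0; apply/eqP; rewrite -normr_eq0 cabs_normr z0. Qed.

Lemma cabs1 : cabs (1 : C) = 1.
Proof. by apply: (@complexI R); rewrite -cabs_normr normr1. Qed.

Lemma cabsM (z w : C) : cabs (z * w) = cabs z * cabs w.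
Proof. by apply: (@complexI R); rewrite rmorphM /= -!cabs_normr normrM. Qed.

Lemma cabsD (z w : C) : cabs (z + w) <= cabs z + cabs w.
Proof. by rewrite -lecR rmorphD /= -!cabs_normr ler_normD. Qed.

Lemma cabs_real (x : R) : cabs (real_complex R x) = `|x|.
Proof. by rewrite /cabs /cabs2 /= expr0n addr0 sqrtr_sqr. Qed.

Lemma cabs2E (z : C) : cabs2 z = cabs z ^+ 2.
Proof. by rewrite sqr_sqrtr // addr_ge0 ?sqr_ge0. Qed.

Lemma Re_le_cabs (z : C) : `|complex.Re z| <= cabs z.
Proof. by rewrite -sqrtr_sqr ler_wsqrtr // lerDl sqr_ge0. Qed.

Lemma Im_le_cabs (z : C) : `|complex.Im z| <= cabs z.
Proof. by rewrite -sqrtr_sqr ler_wsqrtr // lerDr sqr_ge0. Qed.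

Lemma cabs_le_ReIm (z : C) : cabs z <= `|complex.Re z| + `|complex.Im z|.
Proof.
rewrite -(ger0_norm (addr_ge0 (normr_ge0 (complex.Re z)) (normr_ge0 (complex.Im z)))).
rewrite -sqrtr_sqr ler_wsqrtr // sqrrD !real_normK ?num_real //.
by rewrite /cabs2 lerD2r lerDl mulrn_wge0 // mulr_ge0.
Qed.

Lemma cabs_sum (I : Type) (r : seq I) (F : I -> C) :
  cabs (\sum_(i <- r) F i) <= \sum_(i <- r) cabs (F i).
Proof.
elim/big_rec2: _ => [|i y x _ le_xy]; first by rewrite cabs0.
by rewrite (le_trans (cabsD _ _)) // lerD2l.
Qed.

(* The entrywise l^1 norm: submultiplicative also for rectangular products. *)
Definition entnorm {m n} (M : 'M[C]_(m, n)) : R := \sum_i \sum_j cabs (M i j).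

Lemma entnorm_ge0 m n (M : 'M[C]_(m, n)) : 0 <= entnorm M.
Proof. by do 2![apply: sumr_ge0 => ? _]; exact: cabs_ge0. Qed.

Lemma entnorm0 m n : entnorm (0 : 'M[C]_(m, n)) = 0.
Proof. by do 2![apply: big1 => ? _]; rewrite mxE cabs0. Qed.

Lemma entnormD m n (M N : 'M[C]_(m, n)) :
  entnorm (M + N) <= entnorm M + entnorm N.
Proof.
rewrite -big_split /=; apply: ler_sum => i _; rewrite -big_split /=.
by apply: ler_sum => j _; rewrite mxE cabsD.
Qed.

Lemma entnormZ m n (c : C) (M : 'M[C]_(m, n)) :
  entnorm (c *: M) = cabs c * entnorm M.
Proof.
rewrite /entnorm mulr_sumr; apply: eq_bigr => i _; rewrite mulr_sumr.
by apply: eq_bigr => j _; rewrite mxE cabsM.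
Qed.

Lemma entnormN m n (M : 'M[C]_(m, n)) : entnorm (- M) = entnorm M.
Proof.
rewrite -scaleN1r entnormZ -[-1 as X in cabs X](_ : real_complex R (-1) = _).
  by rewrite cabs_real normrN1 mul1r.
by rewrite rmorphN1.
Qed.

Lemma entnorm_sum m n (I : Type) (r : seq I) (F : I -> 'M[C]_(m, n)) :
  entnorm (\sum_(i <- r) F i) <= \sum_(i <- r) entnorm (F i).
Proof.
elim/big_rec2: _ => [|i y x _ le_xy]; first by rewrite entnorm0.
by rewrite (le_trans (entnormD _ _)) // lerD2l.
Qed.

Lemma cabs_le_entnorm m n (M : 'M[C]_(m, n)) i j : cabs (M i j) <= entnorm M.
Proof.
rewrite /entnorm (bigD1 i) //= (bigD1 j) //= -addrA lerDl.
by rewrite addr_ge0 ?sumr_ge0 // => *; rewrite ?sumr_ge0 // => *; exact: cabs_ge0.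
Qed.

Lemma entnorm_mul m n p (M : 'M[C]_(m, n)) (N : 'M[C]_(n, p)) :
  entnorm (M *m N) <= entnorm M * entnorm N.
Proof.
rewrite {2}/entnorm mulr_suml; apply: ler_sum => i _.
apply: (@le_trans _ _ (\sum_j \sum_h cabs (M i h) * cabs (N h j))).
  apply: ler_sum => j _; rewrite mxE (le_trans (cabs_sum _ _)) //.
  by apply: ler_sum => h _; rewrite cabsM.
rewrite exchange_big mulr_suml; apply: ler_sum => h _ /=.
rewrite -mulr_sumr ler_wpM2l ?cabs_ge0 // /entnorm (bigD1 h) //= lerDl.
by apply: sumr_ge0 => *; rewrite sumr_ge0 // => *; exact: cabs_ge0.
Qed.

Lemma entnorm1 n : entnorm (1%:M : 'M[C]_n) = n%:R.
Proof.
rewrite /entnorm -[RHS](_ : \sum_(i < n) (1 : R) = _); last first.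
  by rewrite sumr_const card_ord.
apply: eq_bigr => i _; rewrite (bigD1 i) //= mxE eqxx cabs1 big1 ?addr0 //.
by move=> j ji; rewrite mxE eq_sym (negPf ji) cabs0.
Qed.

(** The factor [n] pays for [j = 0], as the identity has entrywise norm [n]. *)
Lemma entnormX n (M : 'M[C]_n) j : entnorm (M ^+ j) <= n%:R * entnorm M ^+ j.
Proof.
elim: j => [|j IH]; first by rewrite !expr0 mulr1 -entnorm1.
rewrite !exprS (le_trans (entnorm_mul _ _)) // mulrCA.
by rewrite ler_wpM2l ?entnorm_ge0.
Qed.

Lemma cvnorm_ge0 n (v : 'cV[C]_n) : 0 <= cvnorm v.
Proof. exact: sqrtr_ge0. Qed.

Lemma sqr_cvnorm n (v : 'cV[C]_n) : cvnorm v ^+ 2 = \sum_i cabs (v i 0) ^+ 2.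
Proof.
under eq_bigr do rewrite -cabs2E; rewrite sqr_sqrtr // sumr_ge0 // => i _.
by rewrite cabs2E sqr_ge0.
Qed.

Lemma cabs_le_cvnorm n (v : 'cV[C]_n) i : cabs (v i 0) <= cvnorm v.
Proof.
rewrite -(@ler_pXn2r _ 2) ?nnegrE ?cabs_ge0 ?cvnorm_ge0 // sqr_cvnorm.
by rewrite (bigD1 i) //= lerDl sumr_ge0 // => j _; rewrite sqr_ge0.
Qed.

Lemma entnorm_le_cvnorm n (v : 'cV[C]_n) : entnorm v <= n%:R * cvnorm v.
Proof.
apply: (@le_trans _ _ (\sum_(i < n) cvnorm v)); last first.
  by rewrite sumr_const card_ord mulr_natl.
by apply: ler_sum => i _; rewrite big_ord1 cabs_le_cvnorm.
Qed.

Lemma cvnorm0 n : cvnorm (0 : 'cV[C]_n) = 0.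
Proof.
apply/eqP; rewrite -(@eqrXn2 _ 2) ?cvnorm_ge0 // sqr_cvnorm expr0n /= big1 //.
by move=> i _; rewrite mxE cabs0 expr0n.
Qed.

Lemma cvnorm0_eq0 n (v : 'cV[C]_n) : cvnorm v = 0 -> v = 0.
Proof.
move=> v0; apply/matrixP => i j; rewrite ord1 mxE; apply: cabs0_eq0.
by apply/eqP; rewrite eq_le cabs_ge0 -v0 cabs_le_cvnorm.
Qed.

Lemma cvnormZ n (c : C) (v : 'cV[C]_n) : cvnorm (c *: v) = cabs c * cvnorm v.
Proof.
apply/eqP; rewrite -(@eqrXn2 _ 2) ?mulr_ge0 ?cvnorm_ge0 ?cabs_ge0 //.
rewrite exprMn !sqr_cvnorm mulr_sumr; apply/eqP/eq_bigr => i _.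
by rewrite mxE cabsM exprMn.
Qed.

(* Minkowski, by optimizing t in (a + b)^2 <= (1 + t) a^2 + (1 + 1/t) b^2. *)
Lemma cvnormD n (u v : 'cV[C]_n) : cvnorm (u + v) <= cvnorm u + cvnorm v.
Proof.
have [/cvnorm0_eq0->|nu] := eqVneq (cvnorm u) 0.
  by rewrite cvnorm0 !add0r.
have [/cvnorm0_eq0->|nv] := eqVneq (cvnorm v) 0.
  by rewrite cvnorm0 !addr0.
have pu : 0 < cvnorm u by rewrite lt_def nu cvnorm_ge0.
have pv : 0 < cvnorm v by rewrite lt_def nv cvnorm_ge0.
have [su sv] := (sqr_cvnorm u, sqr_cvnorm v).
rewrite -(@ler_pXn2r _ 2) ?nnegrE ?addr_ge0 ?cvnorm_ge0 //.
set p := cvnorm u in nu pu su *; set q := cvnorm v in nv pv sv *.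
have -> : (p + q) ^+ 2 = (1 + q / p) * p ^+ 2 + (1 + p / q) * q ^+ 2.
  by field; rewrite nu nv.
rewrite su sv sqr_cvnorm !mulr_sumr -big_split; apply: ler_sum => i _ /=.
rewrite mxE; set a := cabs (u i 0); set b := cabs (v i 0).
apply: (@le_trans _ _ ((a + b) ^+ 2)).
  by rewrite ler_pXn2r ?nnegrE ?addr_ge0 ?cabs_ge0 // cabsD.
rewrite -subr_ge0.
have -> : (1 + q / p) * a ^+ 2 + (1 + p / q) * b ^+ 2 - (a + b) ^+ 2 =
  (q * a - p * b) ^+ 2 / (p * q) by field; rewrite nu nv.
by rewrite divr_ge0 ?sqr_ge0 // mulr_ge0 // ltW.
Qed.

Lemma cvnorm_le_entnorm n (v : 'cV[C]_n) : cvnorm v <= entnorm v.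
Proof.
rewrite -(@ler_pXn2r _ 2) ?nnegrE ?cvnorm_ge0 ?entnorm_ge0 // sqr_cvnorm.
rewrite [X in _ <= X]expr2 [X in _ <= X * _]/entnorm mulr_suml.
apply: ler_sum => i _; rewrite big_ord1 expr2.
by rewrite ler_wpM2l ?cabs_ge0 ?cabs_le_entnorm.
Qed.

Lemma cvnorm_real n (v : 'cV[R]_n) :
  cvnorm (map_mx (real_complex R) v) = rvnorm v.
Proof.
rewrite /cvnorm /rvnorm; congr Num.sqrt; apply: eq_bigr => i _.
by rewrite mxE cabs2E cabs_real real_normK ?num_real.
Qed.

Lemma cvnorm_mul_le_entnorm n (M : 'M[C]_n) (v : 'cV[C]_n) :
  cvnorm (M *m v) <= entnorm M * n%:R * cvnorm v.
Proof.
rewrite (le_trans (cvnorm_le_entnorm _)) // (le_trans (entnorm_mul _ _)) //.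
by rewrite -mulrA ler_wpM2l ?entnorm_ge0 ?entnorm_le_cvnorm.
Qed.

(** Rescaling [v] to norm 1 places the quotient in the set whose supremum is [spec_norm M]. The
    crude entrywise estimate shows that this set is bounded above, so that the supremum is
    meaningful. *)
Lemma spec_normP n (M : 'M[C]_n) (v : 'cV[C]_n) :
  cvnorm (M *m v) <= spec_norm M * cvnorm v.
Proof.
have [/cvnorm0_eq0->|nv] := eqVneq (cvnorm v) 0.
  by rewrite mulmx0 cvnorm0 mulr0.
have pv : 0 < cvnorm v by rewrite lt_def nv cvnorm_ge0.
rewrite -ler_pdivrMr //.
set c := real_complex R (cvnorm v)^-1.
have cc : cabs c = (cvnorm v)^-1 by rewrite cabs_real ger0_norm // invr_ge0 ltW.
have -> : cvnorm (M *m v) / cvnorm v = cvnorm (M *m (c *: v)).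
  by rewrite -scalemxAr cvnormZ cc mulrC.
apply: ub_le_sup; last first.
  by exists (c *: v) => //=; rewrite cvnormZ cc mulVf.
exists (entnorm M * n%:R) => _ [w /= w1 <-].
rewrite (le_trans (cvnorm_mul_le_entnorm _ _)) // ler_piMr //.
by rewrite mulr_ge0 ?entnorm_ge0.
Qed.

End ComplexNorms.

(** * Partial sums of the matrix exponential and their convergence *)

Section MatrixExponential.
Variable R : realType.
Local Notation C := (complex R).
Local Open Scope classical_set_scope.

(** For [0 <= x <= y] all terms are nonnegative, so the partial sums increase to their limit. *)
Lemma sum_exp_coeffB_le (x y : R) N : 0 <= x <= y ->
  \sum_(j < N) (y ^+ j / j`!%:R - x ^+ j / j`!%:R) <= expR y - expR x.
Proof.
move=> /andP[x0 xy].
have c z := @is_cvg_series_exp_coeff R z.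
have -> : \sum_(j < N) (y ^+ j / j`!%:R - x ^+ j / j`!%:R) =
          (series (exp_coeff y) - series (exp_coeff x)) N.
  by rewrite sumrB !fctE /series /= !big_mkord.
rewrite /expR -limB //; apply: nondecreasing_cvgn_le; last exact: is_cvgB.
apply/nondecreasing_seqP => m; rewrite !fctE /series /= !big_nat_recr //=.
have le : x ^+ m / m`!%:R <= y ^+ m / m`!%:R.
  by rewrite ler_wpM2r ?invr_ge0 // lerXn2r ?nnegrE // (le_trans x0).
by rewrite opprD addrACA lerDl subr_ge0.
Qed.

Lemma sum_exp_coeff_le (x : R) N : 0 <= x ->
  \sum_(j < N) x ^+ j / j`!%:R <= expR x.
Proof.
move=> x0; have -> : \sum_(j < N) x ^+ j / j`!%:R = series (exp_coeff x) N.
  by rewrite /series /= big_mkord.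
apply: nondecreasing_cvgn_le; last exact: is_cvg_series_exp_coeff.
by apply: nondecreasing_series => j _ _; exact: exp_coeff_ge0.
Qed.

Lemma exp_partialZ n (J : 'M[C]_n) (tau : R) N :
  exp_partial (real_complex R tau *: J) N =
  \sum_(j < N) real_complex R (tau ^+ j / j`!%:R) *: J ^+ j.
Proof.
apply: eq_bigr => j _; have -> : (real_complex R tau *: J) ^+ j =
    real_complex R (tau ^+ j) *: J ^+ j.
  elim: (j : nat) => [|m IH]; first by rewrite !expr0 scale1r.
  rewrite !exprS IH -[LHS]/((_ *: _) *m (_ *: _)) -scalemxAl -scalemxAr.
  by rewrite scalerA -rmorphM.
by rewrite scalerA mulrC rmorphM fmorphV rmorph_nat.
Qed.

(** Common comparison with a scalar series, used once with exponential coefficients and once with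
    differences of them. *)
Lemma entnorm_sumX n (J : 'M[C]_n) (c d : nat -> R) N :
  (forall j, `|c j| * entnorm J ^+ j <= d j) ->
  entnorm (\sum_(j < N) real_complex R (c j) *: J ^+ j) <=
  n%:R * \sum_(j < N) d j.
Proof.
move=> cd; rewrite (le_trans (entnorm_sum _ _)) // mulr_sumr.
apply: ler_sum => j _; rewrite entnormZ cabs_real.
apply: (@le_trans _ _ (`|c j| * (n%:R * entnorm J ^+ j))).
  by rewrite ler_wpM2l ?entnormX.
by rewrite mulrCA ler_wpM2l.
Qed.

Lemma entnorm_exp_partial n (J : 'M[C]_n) (tau : R) N : 0 <= tau ->
  entnorm (exp_partial (real_complex R tau *: J) N) <=
  n%:R * expR (tau * entnorm J).
Proof.
move=> t0; have tJ : 0 <= tau * entnorm J by rewrite mulr_ge0 ?entnorm_ge0.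
rewrite exp_partialZ.
apply: (@le_trans _ _ (n%:R * \sum_(j < N) exp_coeff (tau * entnorm J) j)).
  apply: (@entnorm_sumX _ _ (fun j => tau ^+ j / j`!%:R)).
  move=> j; rewrite /exp_coeff /= exprMn ger0_norm ?divr_ge0 ?exprn_ge0 //.
  by rewrite mulrAC.
by rewrite ler_wpM2l // sum_exp_coeff_le.
Qed.

Lemma entnorm_exp_partialB n (J : 'M[C]_n) (tau eta : R) N :
  0 <= tau -> 0 <= eta ->
  entnorm (exp_partial (real_complex R tau *: J) N -
           exp_partial (real_complex R eta *: J) N) <=
  n%:R * `|expR (tau * entnorm J) - expR (eta * entnorm J)|.
Proof.
(* The claim is symmetric in the two times; once they are ordered, all coefficient differences are
   nonnegative and the absolute values drop termwise. *)
wlog le_te : tau eta / eta <= tau.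
  move=> th t0 e0; have [le|/ltW le] := leP eta tau; first exact: th.
  by rewrite -opprB entnormN distrC th.
move=> t0 e0; have J0 := entnorm_ge0 J.
have le : eta * entnorm J <= tau * entnorm J by rewrite ler_wpM2r.
rewrite [X in _ * X]ger0_norm ?subr_ge0 ?ler_expR //.
rewrite !exp_partialZ -sumrB.
under eq_bigr do rewrite -scalerBl -rmorphB.
apply: (@le_trans _ _ (n%:R * \sum_(j < N)
   ((tau * entnorm J) ^+ j / j`!%:R - (eta * entnorm J) ^+ j / j`!%:R))).
  apply: (@entnorm_sumX _ _ (fun j => tau ^+ j / j`!%:R - eta ^+ j / j`!%:R)
     (fun j => (tau * entnorm J) ^+ j / j`!%:R -
               (eta * entnorm J) ^+ j / j`!%:R)) => j.
  rewrite ger0_norm; first by rewrite !exprMn; lra.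
  by rewrite subr_ge0 ler_wpM2r ?invr_ge0 // lerXn2r.
by rewrite ler_wpM2l // sum_exp_coeffB_le // le mulr_ge0.
Qed.

(** Real and imaginary parts are dominated by the modulus, so each is an absolutely convergent real
    series. Convergence is phrased through the real distance [cabs], the form used in [is_expm]. *)
Lemma cvg_abs_series_complex (u : nat -> C) (v : R^nat) :
  (forall j, cabs (u j) <= v j) -> cvgn (series v) ->
  exists l : C, cabs (\sum_(j < N) u j - l) @[N --> \oo] --> (0 : R).
Proof.
move=> uv cv; have v0 j : 0 <= v j by exact: le_trans (cabs_ge0 _) (uv j).
have cvgf (f : C -> R) : (forall z, `|f z| <= cabs z) -> cvgn (series (f \o u)).
  move=> fc; apply: normed_cvg; apply: (@series_le_cvg _ (fun j => `|f (u j)|) v) => // j.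
  exact: le_trans (fc _) (uv j).
have cre := cvgf (@complex.Re R) (@Re_le_cabs R).
have cim := cvgf (@complex.Im R) (@Im_le_cabs R).
exists (Complex (limn (series (@complex.Re R \o u))) (limn (series (@complex.Im R \o u)))).
set l := Complex _ _.
apply: (@squeeze_cvgr _ _ _ _ (fun=> 0)
  (fun N => `|series (@complex.Re R \o u) N - complex.Re l| +
            `|series (@complex.Im R \o u) N - complex.Im l|)).
- near=> N; rewrite cabs_ge0 (le_trans (cabs_le_ReIm _)) //=.
  rewrite !raddfB !raddf_sum /series /= !big_mkord; exact: lexx.
- exact: cvg_cst.
rewrite -[X in _ --> X](addr0 0); apply: cvgD; apply/norm_cvg0P/subr_cvg0.
  exact: cre.
exact: cim.
Unshelve. all: by end_near. Qed.

(** [expm] falls back on the zero matrix if no limit exists; entrywise domination by [n] times the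
    scalar exponential series of [entnorm M] provides the limit. *)
Lemma is_expm_expm n (M : 'M[C]_n) : is_expm M (expm M).
Proof.
suff exE : exists E, is_expm M E.
  exact: (@xgetPex _ 0 [set E | is_expm M E] exE).
have key (p : 'I_n * 'I_n) : exists l : C,
    cabs (exp_partial M N p.1 p.2 - l) @[N --> \oo] --> (0 : R).
  have [||l ul] := @cvg_abs_series_complex
    (fun j => (j`!%:R)^-1 * (M ^+ j) p.1 p.2)
    ((n%:R : R) *: exp_coeff (entnorm M)).
  - move=> j; rewrite cabsM !fctE /exp_coeff /GRing.scale /= -(rmorph_nat (real_complex R)) -fmorphV.
    rewrite cabs_real ger0_norm ?invr_ge0 // mulrA [X in _ <= X]mulrC.
    by rewrite ler_wpM2l ?invr_ge0 // (le_trans (cabs_le_entnorm _ _ _)) ?entnormX.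
  - by apply: is_cvg_seriesZ; exact: is_cvg_series_exp_coeff.
  exists l; apply: cvg_trans ul; apply: near_eq_cvg; near=> N.
  rewrite /exp_partial summxE; congr (cabs (_ - _)).
  by apply: eq_bigr => j _; rewrite mxE.
have [f fP] := choice key.
exists (\matrix_(i, j) f (i, j)) => i j eps eps0.
have /cvgrPdist_lt/(_ _ eps0)[N0 _ H] := fP (i, j).
exists N0 => N NN0; have := H N NN0.
by rewrite /= sub0r normrN mxE ger0_norm ?cabs_ge0.
Unshelve. all: by end_near. Qed.

Lemma cvgn_sum0 (I : Type) (r : seq I) (f : I -> nat -> R) :
  (forall i, f i N @[N --> \oo] --> (0 : R)) ->
  \sum_(i <- r) f i N @[N --> \oo] --> (0 : R).
Proof.
move=> f0; elim: r => [|i r IH].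
  by under eq_fun do rewrite big_nil; exact: cvg_cst.
under eq_fun do rewrite big_cons.
by have H := cvgD (f0 i) IH; rewrite addr0 in H; exact: H.
Qed.

Lemma expm_cvg n (M : 'M[C]_n) :
  entnorm (exp_partial M N - expm M) @[N --> \oo] --> (0 : R).
Proof.
apply: cvgn_sum0 => i; apply: cvgn_sum0 => j.
apply/cvgrPdist_lt => eps eps0; have [N0 H] := is_expm_expm M i j eps0.
exists N0 => // N NN0; rewrite /= sub0r normrN ger0_norm ?cabs_ge0 //.
by rewrite !mxE; exact: H.
Qed.

End MatrixExponential.

(** * Taylor sums and solutions of a constant-coefficient linear equation *)

Section LinearODE.
Variable R : realType.
Local Open Scope classical_set_scope.

Lemma within_continuousB (D : set R) (f g : R -> R) :
  {within D, continuous f} -> {within D, continuous g} ->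
  {within D, continuous (f - g)}.
Proof.
by move=> cf cg x; apply: continuousD _; [exact: cf|apply/continuousN/cg].
Qed.

(** Both [g - f] and [g + f] vanish at [a] and have nonnegative derivative. Derivatives are taken in
    the open interval only, because a solution may fail to be differentiable at switching times. *)
Lemma le_norm_of_derive (f g df dg : R -> R) (a b : R) :
  {within `[a, b], continuous f} -> {within `[a, b], continuous g} ->
  (forall s, s \in `]a, b[%R ->
     [/\ is_derive s 1 f (df s), is_derive s 1 g (dg s) & `|df s| <= dg s]) ->
  f a = 0 -> g a = 0 -> forall s, a <= s <= b -> `|f s| <= g s.
Proof.
move=> cf cg dfg fa ga s /andP[sa sb].
have mono (h dh : R -> R) : {within `[a, b], continuous h} ->
    (forall s, s \in `]a, b[%R -> is_derive s 1 h (dh s)) ->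
    (forall s, s \in `]a, b[%R -> `|dh s| <= dg s) -> h a = 0 -> h s <= g s.
  move=> ch dhP hg ha; rewrite -subr_ge0.
  have -> : 0 = (g - h) a by rewrite !fctE ga ha subrr.
  have dgh x : x \in `]a, b[%R -> is_derive x 1 (g - h) (dg x - dh x).
    by move=> xab; have [_ ? _] := dfg _ xab; have ? := dhP _ xab; exact: is_deriveB.
  apply: (@ger0_derive1_ndecr _ (g - h) a b) => //.
  - by move=> x /dgh.
  - move=> x xab; have dx := dgh _ xab; rewrite derive1E derive_val subr_ge0.
    by rewrite (le_trans (ler_norm _)) // hg.
  - exact: within_continuousB.
rewrite ler_norml lerNl; apply/andP; split; last first.
  by apply: (mono f df) => // x xab; have [] := dfg _ xab.
apply: (mono (- f) (- df)).
- by move=> x; apply/continuousN/cf.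
- by move=> x xab; have [? _ _] := dfg _ xab; exact: is_deriveN.
- by move=> x xab; have [_ _] := dfg _ xab; rewrite normrN.
- by rewrite !fctE fa oppr0.
Qed.

(** The coefficients are arbitrary so as to cover both the Taylor sum of a solution and a single
    monomial. *)
Lemma is_derive_taylor_sum (c : nat -> R) (a s : R) N :
  is_derive s 1 (fun s => \sum_(j < N.+1) (s - a) ^+ j / j`!%:R * c j)
    (\sum_(j < N) (s - a) ^+ j / j`!%:R * c j.+1).
Proof.
elim: N => [|N IH].
  rewrite big_ord0 (_ : (fun _ => _) = cst (c 0%N)); first exact: is_derive_cst.
  by apply/funext => x; rewrite big_ord1 expr0 fact0 divr1 mul1r.
rewrite (_ : (fun s => _) = (fun s => \sum_(j < N.+1) (s - a) ^+ j / j`!%:R * c j)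
   + (fun s => (s - a) ^+ N.+1 / N.+1`!%:R * c N.+1)); last first.
  by apply/funext => x; rewrite !fctE big_ord_recr.
rewrite big_ord_recr /=; apply: is_deriveD.
rewrite (_ : (fun s => _) = (c N.+1 / N.+1`!%:R) *: ((id - cst a) ^+ N.+1)); last first.
  by apply/funext => x; rewrite !fctE /= mulrC mulrA mulrAC.
apply: is_derive_eq.
rewrite !fctE subr0 /GRing.scale /= mulr1 factS natrM.
by field; rewrite addrC natr1 !pnatr_eq0 -lt0n fact_gt0.
Qed.

Definition abssum n (A : 'M[R]_n) : R := \sum_i \sum_j `|A i j|.

Lemma mulmx_entry_le n (A : 'M[R]_n) (v : 'cV[R]_n) (c : R) i :
  (forall j, `|v j 0| <= c) -> `|(A *m v) i 0| <= abssum A * c.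
Proof.
move=> vc; have c0 : 0 <= c by exact: le_trans (normr_ge0 _) (vc i).
rewrite mxE (le_trans (ler_norm_sum _ _ _)) //.
apply: (@le_trans _ _ (\sum_j `|A i j| * c)).
  by apply: ler_sum => j _; rewrite normrM ler_wpM2l.
rewrite -mulr_suml ler_wpM2r // /abssum [X in _ <= X](bigD1 i) //= lerDl sumr_ge0 // => *.
by rewrite sumr_ge0.
Qed.

Lemma continuous_taylor_sum (c : nat -> R) (a : R) N :
  continuous (fun s => \sum_(j < N) (s - a) ^+ j / j`!%:R * c j).
Proof.
case: N => [|N] s.
  rewrite (_ : (fun _ => _) = cst 0); first exact: cst_continuous.
  by apply/funext => x; rewrite big_ord0.
apply: differentiable_continuous; apply/derivable1_diffP.
by have := is_derive_taylor_sum c a s N => -[].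
Qed.

(* Picard iteration: subtracting the N-th Taylor sum from a solution leaves a
   remainder whose derivative is A times the previous remainder. *)
Lemma picard_remainder n (A : 'M[R]_n) (x : R -> 'cV[R]_n) (a b c : R) :
  (forall i, {within `[a, b], continuous (fun s => x s i 0)}) ->
  (forall s, s \in `]a, b[%R -> forall i,
     is_derive s 1 (fun s => x s i 0) ((A *m x s) i 0)) ->
  (forall s, a <= s <= b -> forall i, `|x s i 0| <= c) ->
  forall N s i, a <= s <= b ->
  `|x s i 0 - \sum_(j < N) (s - a) ^+ j / j`!%:R * (A ^+ j *m x a) i 0|
  <= c * (abssum A ^+ N * ((s - a) ^+ N / N`!%:R)).
Proof.
move=> cx dx xc; elim=> [|N IH] s i sab.
  by rewrite big_ord0 subr0 !expr0 fact0 divr1 !mulr1 xc.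
pose w N s := x s - \sum_(j < N) ((s - a) ^+ j / j`!%:R) *: (A ^+ j *m x a).
have wE m t h : w m t h 0 =
    x t h 0 - \sum_(j < m) (t - a) ^+ j / j`!%:R * (A ^+ j *m x a) h 0.
  by rewrite !mxE summxE; congr (_ - _); apply: eq_bigr => j _; rewrite mxE.
rewrite -wE.
(* The bound is written as a Taylor sum with one nonzero coefficient, so its derivative and
   continuity come from the lemmas on such sums. *)
pose g t := \sum_(j < N.+2) (t - a) ^+ j / j`!%:R *
              (if j == N.+1 :> nat then c * abssum A ^+ N.+1 else 0).
have gE t : g t = c * (abssum A ^+ N.+1 * ((t - a) ^+ N.+1 / N.+1`!%:R)).
  rewrite /g big_ord_recr /= eqxx big1 ?add0r; first by ring.
  by move=> j _; rewrite ltn_eqF ?mulr0.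
rewrite -gE; apply: (@le_norm_of_derive (fun t => w N.+1 t i 0) g
  (fun t => (A *m w N t) i 0)
  (fun t => c * (abssum A ^+ N.+1 * ((t - a) ^+ N / N`!%:R))) a b) => //.
- rewrite (_ : (fun s => _) = (fun t => x t i 0) - (fun t =>
     \sum_(j < N.+1) (t - a) ^+ j / j`!%:R * (A ^+ j *m x a) i 0)); last first.
    by apply/funext => t; rewrite wE.
  apply: within_continuousB; first exact: cx.
  apply: continuous_subspaceT.
  exact: (@continuous_taylor_sum (fun j => (A ^+ j *m x a) i 0) a N.+1).
- apply: continuous_subspaceT.
  exact: (@continuous_taylor_sum
    (fun j => if j == N.+1 then c * abssum A ^+ N.+1 else 0) a N.+2).
- move=> t tab; have tab' : a <= t <= b.
    by move: tab; rewrite in_itv /= => /andP[/ltW-> /ltW->].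
  split.
  + rewrite (_ : (fun s => _) = (fun t => x t i 0) - (fun t =>
       \sum_(j < N.+1) (t - a) ^+ j / j`!%:R * (A ^+ j *m x a) i 0)); last first.
      by apply/funext => y; rewrite wE.
    have d1 := dx _ tab i.
    have d2 := is_derive_taylor_sum (fun j => (A ^+ j *m x a) i 0) a t N.
    apply: is_derive_eq.
    rewrite mulmxBr !mxE [X in _ = _ - X](_ : _ = (A *m \sum_(j < N)
      ((t - a) ^+ j / j`!%:R) *: (A ^+ j *m x a)) i 0); last by rewrite mxE.
    rewrite mulmx_sumr summxE; congr (_ - _); apply: eq_bigr => j _.
    by rewrite -scalemxAr mulmxA !mxE exprS.
  + have d2 := is_derive_taylor_sum (fun j => if j == N.+1 :> nat
       then c * abssum A ^+ N.+1 else 0) a t N.+1.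
    apply: (is_derive_eq d2).
    rewrite big_ord_recr /= eqxx big1 ?add0r; first by ring.
    by move=> j _; rewrite eqSS ltn_eqF ?mulr0.
  + apply: (le_trans (@mulmx_entry_le _ _ _
        (c * (abssum A ^+ N * ((t - a) ^+ N / N`!%:R))) _ _)).
      by move=> h; rewrite wE IH.
    by rewrite exprS mulrCA -!mulrA.
(* At [a] only the term [j = 0] survives, and it equals [x a]. *)
- by rewrite wE big_ord_recl big1 => [|j _]; rewrite subrr ?expr0n ?mul0r //
   expr0 fact0 divr1 mul1r mul1mx addr0 subrr.
- by rewrite gE subrr expr0n mul0r !mulr0.
Qed.

(** A continuous solution is bounded on the compact interval, so the Picard remainder is at most a
    constant times the [N]-th exponential coefficient, which tends to 0. *)
Lemma cvg_taylor_solution n (A : 'M[R]_n) (x : R -> 'cV[R]_n) (a b : R) :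
  (forall i, {within `[a, b], continuous (fun s => x s i 0)}) ->
  (forall s, s \in `]a, b[%R -> forall i,
     is_derive s 1 (fun s => x s i 0) ((A *m x s) i 0)) ->
  forall s i, a <= s <= b ->
  `|(\sum_(j < N) ((s - a) ^+ j / j`!%:R) *: (A ^+ j *m x a) - x s) i 0|
    @[N --> \oo] --> (0 : R).
Proof.
move=> cx dx s i sab; have ab : a <= b by case/andP: sab; exact: le_trans.
have bnd h : exists c : R, forall t, a <= t <= b -> `|x t h 0| <= c.
  have ch : {within `[a, b], continuous (fun t => `|x t h 0|)}.
    by move=> t; apply: cvg_norm; exact: cx.
  have [m _ mP] := EVT_max ab ch; exists `|x m h 0| => t tab.
  by apply: mP; rewrite in_itv.
have [f fP] := choice bnd.
pose c := \sum_h f h.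
have f0 h : 0 <= f h by apply: (le_trans _ (fP h a _)); rewrite ?lexx.
have xc t : a <= t <= b -> forall h, `|x t h 0| <= c.
  move=> tab h; rewrite (le_trans (fP h t tab)) // /c (bigD1 h) //= lerDl.
  by rewrite sumr_ge0.
apply: (@squeeze_cvgr _ _ _ _ (fun=> 0)
   (fun N => c * exp_coeff (abssum A * (s - a)) N)).
- near=> N; rewrite normr_ge0 /=.
  rewrite /exp_coeff /= exprMn -[X in c * X]mulrA !mxE summxE distrC.
  under eq_bigr do rewrite mxE.
  exact: (picard_remainder cx dx xc N i sab).
- exact: cvg_cst.
- by rewrite -(mulr0 c); apply: cvgM; [exact: cvg_cst|exact: cvg_exp_coeff].
Unshelve. all: by end_near. Qed.

End LinearODE.

(** * Flow of one mode in the coordinates [z = P^-1 x] *)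

Section ModeFlow.
Variable R : realType.
Local Notation C := (complex R).
Local Notation rc := (real_complex R).
Local Open Scope classical_set_scope.

(** Removes a truncation error from an estimate valid for all [N]. *)
Lemma le_of_cvg0 (X c : R) (r : nat -> R) :
  r N @[N --> \oo] --> (0 : R) -> (forall N, X <= c + r N) -> X <= c.
Proof.
move=> r0 H; apply: (@cvgr_to_ge _ \oo _ _ (fun N => c + r N)).
  by rewrite -[X in _ --> X](addr0 c); apply: cvgD r0; exact: cvg_cst.
by near=> N; exact: H.
Unshelve. all: by end_near. Qed.

Lemma conjmxX n (M P J : 'M[C]_n) j : P \in unitmx ->
  M = P *m J *m invmx P -> M ^+ j = P *m J ^+ j *m invmx P.
Proof.
move=> Pu ->; elim: j => [|j IH]; first by rewrite !expr0 mulmx1 mulmxV.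
rewrite !exprS IH -!mulmxE !mulmxA; congr (_ *m _ *m _).
by rewrite -[RHS]mulmx1 -(mulVmx Pu) !mulmxA.
Qed.

(** Conjugation by [P] commutes with powers, so each term in [A] becomes the corresponding term in
    [J]. *)
Lemma map_taylor_conj n (A : 'M[R]_n) (P J : 'M[C]_n) (v : 'cV[R]_n) tau N :
  P \in unitmx -> map_mx rc A = P *m J *m invmx P ->
  invmx P *m map_mx rc (\sum_(j < N) (tau ^+ j / j`!%:R) *: (A ^+ j *m v)) =
  exp_partial (rc tau *: J) N *m (invmx P *m map_mx rc v).
Proof.
move=> Pu AJ; rewrite exp_partialZ map_mx_sum mulmx_sumr mulmx_suml.
apply: eq_bigr => j _; rewrite map_mxZ map_mxM -scalemxAr -scalemxAl.
congr (_ *: _); have -> : map_mx rc (A ^+ j) = map_mx rc A ^+ j.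
  elim: (j : nat) => [|m IH]; first by rewrite !expr0 map_mx1.
  by rewrite !exprS -!mulmxE map_mxM IH.
by rewrite (conjmxX _ Pu AJ) !mulmxA mulVmx // mul1mx.
Qed.

Section Flow.
Variables (n : nat) (A : 'M[R]_n) (P J : 'M[C]_n) (x : R -> 'cV[R]_n) (a b : R).
Hypothesis Pu : P \in unitmx.
Hypothesis AJ : map_mx rc A = P *m J *m invmx P.
Hypothesis cx : forall i, {within `[a, b], continuous (fun s => x s i 0)}.
Hypothesis dx : forall s, s \in `]a, b[%R -> forall i,
     is_derive s 1 (fun s => x s i 0) ((A *m x s) i 0).

Let z s := invmx P *m map_mx rc (x s).

(** The error is [invmx P] applied to the complexified Taylor error [D N], which tends to 0
    entrywise. *)
Lemma cvg_flow s : a <= s <= b ->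
  entnorm (exp_partial (rc (s - a) *: J) N *m z a - z s) @[N --> \oo] --> (0 : R).
Proof.
move=> sab; pose D N := \sum_(j < N) ((s - a) ^+ j / j`!%:R) *: (A ^+ j *m x a) - x s.
apply: (@squeeze_cvgr _ _ _ _ (fun=> 0)
   (fun N => entnorm (invmx P) * \sum_i `|D N i 0|)).
- near=> N; rewrite entnorm_ge0 -(map_taylor_conj _ _ _ Pu AJ) /z -mulmxBr -map_mxB.
  rewrite (le_trans (entnorm_mul _ _)) // ler_wpM2l ?entnorm_ge0 //.
  by apply: ler_sum => i _; rewrite big_ord1 [map_mx _ _ _ _]mxE cabs_real.
- exact: cvg_cst.
rewrite -[X in _ --> X](mulr0 (entnorm (invmx P))); apply: cvgM; first exact: cvg_cst.
apply: (@cvgn_sum0 R _ _ (fun i N => `|D N i 0|)) => i.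
exact: (cvg_taylor_solution cx dx i sab).
Unshelve. all: by end_near. Qed.

(** Growth control for the incomplete last dwell, where no contraction is available. *)
Lemma flow_entnorm_le s : a <= s <= b ->
  entnorm (z s) <= n%:R * expR ((s - a) * entnorm J) * entnorm (z a).
Proof.
move=> sab; have sa0 : 0 <= s - a by case/andP: sab; rewrite subr_ge0.
apply: (le_of_cvg0 (cvg_flow sab)) => N.
set S := exp_partial _ _.
have -> : z s = S *m z a - (S *m z a - z s) by rewrite subKr.
rewrite (le_trans (entnormD _ _)) // entnormN [_ - (_ - _)]subKr lerD2r.
rewrite (le_trans (entnorm_mul _ _)) // ler_wpM2r ?entnorm_ge0 //.
exact: entnorm_exp_partial.
Qed.

(** [Q] stands for the change of coordinates at a switch and [eta] for the reference dwell time,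
    which makes the first summand the norm assumed below 1. One factor [n] comes from the powers of
    [J], the other from comparing the two vector norms. *)
Lemma flow_cvnorm_le (Q : 'M[C]_n) (eta s : R) : 0 <= eta -> a <= s <= b ->
  cvnorm (Q *m z s) <=
  (spec_norm (Q *m expm (rc eta *: J)) + entnorm Q * n%:R * n%:R *
     `|expR ((s - a) * entnorm J) - expR (eta * entnorm J)|) * cvnorm (z a).
Proof.
move=> eta0 sab; have sa0 : 0 <= s - a by case/andP: sab; rewrite subr_ge0.
pose S := exp_partial (rc (s - a) *: J).
pose T := exp_partial (rc eta *: J); pose E := expm (rc eta *: J).
apply: (@le_of_cvg0 _ _ (fun N => entnorm Q * entnorm (S N *m z a - z s) +
   entnorm Q * (entnorm (T N - E) * entnorm (z a)))) => [|N].
  rewrite -[X in _ --> X](_ : entnorm Q * 0 + entnorm Q * (0 * entnorm (z a)) = _).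
    apply: cvgD; apply: cvgM; try exact: cvg_cst; first exact: cvg_flow.
    by apply: cvgM; [exact: expm_cvg|exact: cvg_cst].
  by rewrite mul0r mulr0 addr0.
(* Compare through the sums at both times and the limit [E]. The first two terms give the bound
   uniformly in [N]; the last two are truncation errors. *)
have -> : Q *m z s = Q *m E *m z a + Q *m ((S N - T N) *m z a) +
    (Q *m - (S N *m z a - z s) + Q *m ((T N - E) *m z a)).
  rewrite -mulmxA -!mulmxDr; congr (_ *m _); rewrite !mulmxBl opprB.
  by rewrite addrACA [X in _ + X]addrA subrK [X in X + _]addrC addrA addrAC addrK subrK.
apply: le_trans (cvnormD _ _) _; apply: lerD.
  apply: le_trans (cvnormD _ _) _; rewrite mulrDl; apply: lerD.
    exact: spec_normP.
  apply: le_trans (cvnorm_le_entnorm _) _; apply: le_trans (entnorm_mul _ _) _.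
  rewrite -!mulrA; apply: ler_wpM2l; first exact: entnorm_ge0.
  apply: le_trans (entnorm_mul _ _) _.
  apply: (@le_trans _ _ ((n%:R *
     `|expR ((s - a) * entnorm J) - expR (eta * entnorm J)|) * (n%:R * cvnorm (z a)))).
    apply: ler_pM; rewrite ?entnorm_ge0 //; first exact: entnorm_exp_partialB.
    exact: entnorm_le_cvnorm.
  by rewrite -mulrA [X in _ * X]mulrCA.
apply: le_trans (cvnormD _ _) _; apply: lerD.
  apply: le_trans (cvnorm_le_entnorm _) _; apply: le_trans (entnorm_mul _ _) _.
  by rewrite entnormN.
apply: le_trans (cvnorm_le_entnorm _) _; apply: le_trans (entnorm_mul _ _) _.
by apply: ler_wpM2l; [exact: entnorm_ge0|exact: entnorm_mul].
Qed.

End Flow.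
End ModeFlow.

(** * Dwell-time windows, uniform rates and switching signals *)

Section SwitchedSystem.
Variable R : realType.
Local Open Scope classical_set_scope.

(** By continuity of the exponential at [eta], the perturbation uses at most half of the slack
    [1 - q]. *)
Lemma expR_gap_window (eta K D q : R) : 0 < eta -> 0 <= D -> q < 1 ->
  exists2 d, 0 < d <= eta & forall tau, `|tau - eta| < d ->
    q + D * `|expR (tau * K) - expR (eta * K)| <= (1 + q) / 2.
Proof.
move=> eta0 D0 q1.
have c : {for eta, continuous (fun tau : R => expR (tau * K))}.
  apply: (@continuous_comp _ _ _ (fun tau : R => tau * K) expR).
    by apply: cvgM; [exact: cvg_id|exact: cvg_cst].
  exact: continuous_expR.
(* The divisor is [D + 1] since [D] may vanish. *)
have eps0 : 0 < (1 - q) / 2 / (D + 1) by rewrite !divr_gt0 // ?subr_gt0 // ltr_wpDl.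
have [d /= d0 dP] := (cvgrPdist_lt _ _).1 c _ eps0.
(* The cap [eta] keeps the left end of the window nonnegative. *)
exists (Num.min d eta); first by rewrite lt_min d0 eta0 ge_min lexx orbT.
move=> tau; rewrite lt_min distrC => /andP[/dP /= + _].
rewrite distrC ltr_pdivlMr ?ltr_wpDl // => lt.
set g := `|_| in lt *; have g0 : 0 <= g by exact: normr_ge0.
by nra.
Qed.

Lemma uniform_lt1 (I : finType) (q : I -> R) : (forall i, q i < 1) ->
  exists2 rho, 0 < rho < 1 & forall i, q i <= rho.
Proof.
(* The seed [1/2] keeps [rho] positive even without edges, so that [ln rho] can be used. *)
move=> q1; exists (\big[Num.max/2^-1]_i q i); last by move=> i; exact: le_bigmax.
apply/andP; split; last by apply: bigmax_lt => //; rewrite invf_lt1 ?ltr1n.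
by rewrite (lt_le_trans _ (bigmax_ge_id _ _ _ _)) // invr_gt0.
Qed.

(** Write [rho ^+ m] as the exponential of [m * ln rho] and use [s / B <= m + 1]; the surplus 1
    costs the factor [expR (- ln rho)], that is [1 / rho]. *)
Lemma exp_decay (rho B s : R) m : 0 < rho < 1 -> 0 < B -> s <= m.+1%:R * B ->
  rho ^+ m <= expR (- ln rho) * expR (- (- ln rho / B * s)).
Proof.
move=> /andP[r0 r1] B0 sB; rewrite -expRD.
rewrite -[X in X ^+ m](lnK (_ : rho \is Num.pos)) // -expRM_natl ler_expR.
have l0 : 0 < - ln rho by rewrite oppr_gt0 ln_lt0 // r0.
have : - ln rho / B * s <= - ln rho * m.+1%:R.
  by rewrite -mulrA ler_pM2l // mulrC ler_pdivrMr.
by rewrite -natr1; lra.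
Qed.

Section Signal.
Variables (n k l : nat) (e : 'I_l -> 'I_k * 'I_k) (a b : 'I_l -> R).
Variables (sigma : R -> 'I_k) (t : nat -> R).
Hypothesis sig : signal_in e a b sigma t.

Lemma signal_lt i j : (t i < t j) = (i < j)%N.
Proof.
case: sig => _ tS _ _ _; have th := homo_ltn (@lt_trans _ R) tS.
have [/th//|/th tji|->] := ltngtP i j; last by rewrite ltxx.
by rewrite ltNge ltW.
Qed.

Lemma signal_ge0 m : 0 <= t m.
Proof.
case: sig => t0 _ _ _ _; rewrite -t0; case: m => // m.
by rewrite ltW // signal_lt.
Qed.

(** Switching times are unbounded, so some least index has [s < t m]; it is not 0 because
    [t 0 = 0 <= s], and its predecessor is the witness. *)
Lemma signal_locate s : 0 <= s -> exists m, t m <= s < t m.+1.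
Proof.
case: sig => t0 _ tinf _ _ s0; have [m0 sm0] := tinf s.
case: (@ex_minnP (fun m => s < t m)); first by exists m0.
case=> [|m] sm min; first by move: sm; rewrite t0 ltNge s0.
exists m; rewrite sm andbT leNgt; apply/negP => /min; by rewrite ltnn.
Qed.

(** Read backwards, this bounds the number of switches from below, turning decay per switch into
    decay in time. *)
Lemma signal_time_le (B : R) m : (forall i, b i <= B) -> t m <= m%:R * B.
Proof.
case: sig => t0 _ _ _ st bB; elim: m => [|m IH]; first by rewrite t0 mul0r.
have [i [_ /andP[_ /ltW]]] := st m; have := bB i; rewrite -natr1; lra.
Qed.

Variables (A : 'I_k -> 'M[R]_n) (x : R -> 'cV[R]_n).
Hypothesis sol : is_solution A sigma t x.

Lemma solution_continuous m i :
  {within `[t m, t m.+1], continuous (fun s => x s i 0)}.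
Proof.
case: sol => cx _.
have cx' : {within `[t m, t m.+1], continuous x}.
  apply: continuous_subspaceW cx => s /=; rewrite in_itv /= => /andP[ms _].
  exact: le_trans (signal_ge0 m) ms.
move=> s; apply: (@cvg_comp _ _ _ x (fun v : 'cV[R]_n => v i 0)); first exact: cx'.
exact: coord_continuous.
Qed.

(** No switching time lies strictly between two consecutive ones, so the equation holds there with
    the mode frozen at [sigma (t m)]. *)
Lemma solution_derive m s : s \in `]t m, t m.+1[%R -> forall i,
  is_derive s 1 (fun s => x s i 0) ((A (sigma (t m)) *m x s) i 0).
Proof.
rewrite in_itv /= => /andP[ms sm] i; case: sol => _ dx.
have s0 : 0 < s by exact: le_lt_trans (signal_ge0 m) ms.
have nt j : s != t j.
  apply/eqP => st; move: ms sm; rewrite st !signal_lt ltnS => mj.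
  by rewrite leqNgt mj.
have [ds Ds] := dx s s0 nt; case: sig => _ _ _ cst _.
rewrite -(cst m s (ltW ms) sm) -Ds derive_mx // mxE.
by apply: DeriveDef => //; move/derivable_mxP: ds; exact.
Qed.

End Signal.
End SwitchedSystem.

(** * Choice of the intervals and global exponential estimate *)

Theorem theorem3p1 (R : realType) (n k l : nat) (e : 'I_l -> 'I_k * 'I_k)
    (A : 'I_k -> 'M[R]_n) (P J : 'I_k -> 'M[complex R]_n) (eta : 'I_l -> R) :
  digraph_no_loops e ->
  (forall r : 'I_k, [/\ P r \in unitmx, is_jordan (J r)
       & map_mx (real_complex R) (A r) = P r *m J r *m invmx (P r)]) ->
  (forall i : 'I_l, 0 < eta i /\
     spec_norm (invmx (P (e i).2) *m P (e i).1 *m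
                expm (real_complex R (eta i) *: J (e i).1)) < 1) ->
  exists a b : 'I_l -> R,
    (forall i : 'I_l, 0 <= a i /\ a i < eta i < b i) /\
    (forall (sigma : R -> 'I_k) (t : nat -> R),
       signal_in e a b sigma t -> GES A sigma t).
Proof.
move=> _ PJ etaP.
pose Q i := invmx (P (e i).2) *m P (e i).1.
pose q i := spec_norm (Q i *m expm (real_complex R (eta i) *: J (e i).1)).
(* The factor of the gap is the one in [flow_cvnorm_le], so staying in the window yields contraction
   by [(1 + q i) / 2]. *)
have window i : exists d : R, 0 < d <= eta i /\ forall tau, `|tau - eta i| < d ->
    q i + entnorm (Q i) * n%:R * n%:R *
      `|expR (tau * entnorm (J (e i).1)) - expR (eta i * entnorm (J (e i).1))|
    <= (1 + q i) / 2.
  have [eta0 q1] := etaP i.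
  have D0 : 0 <= entnorm (Q i) * n%:R * n%:R by rewrite !mulr_ge0 ?entnorm_ge0.
  have [d d0 dP] := expR_gap_window (entnorm (J (e i).1)) eta0 D0 q1.
  by exists d.
have [d dP] := choice window.
have q1 i : (1 + q i) / 2 < 1 by have [_] := etaP i; rewrite -/(q i); lra.
have [rho rho01 rhoP] := uniform_lt1 q1.
exists (fun i => eta i - d i), (fun i => eta i + d i); split=> [i|sigma t sig].
  by have [/andP[d0 d1] _] := dP i; split; [|apply/andP; split]; lra.
(* [B] dominates every admissible dwell time; the added 1 makes it positive in all cases. *)
pose B := 1 + \sum_i (eta i + d i).
have b0 i : 0 <= eta i + d i.
  by have [/andP[d0 d1] _] := dP i; have [e0 _] := etaP i; lra.
have B0 : 0 < B by rewrite ltr_pwDl // sumr_ge0.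
have bB i : eta i + d i <= B.
  by rewrite /B (bigD1 i) //= addrCA lerDl addr_ge0 // sumr_ge0.
pose K := \sum_r entnorm (J r); pose p := \sum_r entnorm (P r).
pose p' := \sum_r entnorm (invmx (P r)).
have le_sum (F : 'I_k -> 'M[complex R]_n) r : entnorm (F r) <= \sum_r entnorm (F r).
  by rewrite (bigD1 r) //= lerDl sumr_ge0 // => *; exact: entnorm_ge0.
have K0 : 0 <= K by rewrite sumr_ge0 // => *; exact: entnorm_ge0.
have p0 : 0 <= p by rewrite sumr_ge0 // => *; exact: entnorm_ge0.
have p'0 : 0 <= p' by rewrite sumr_ge0 // => *; exact: entnorm_ge0.
(* From right to left: passing from [x 0] to [z], flowing through the incomplete last dwell,
   returning to [x]. *)
pose c := p * (n%:R * expR (B * K) * n%:R) * (p' * n%:R).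
have c0 : 0 <= c by rewrite !mulr_ge0 ?expR_ge0.
have lrho : 0 < - ln rho by rewrite oppr_gt0 ln_lt0.
(* [c + 1] replaces [c], which may be 0, to get a positive constant; the other factor and the rate
   are those of [exp_decay]. *)
exists ((c + 1) * expR (- ln rho)), (- ln rho / B).
split; first by rewrite mulr_gt0 ?expR_gt0 // ltr_wpDl.
split=> [|x sol s s0]; first exact: divr_gt0.
case: (sig) => t0 tS _ _ st.
(* These are the coordinates of the mode entered at [t m]; at [t m.+1] the old and new coordinates
   differ by [Q i], which [step] absorbs into the contraction. *)
pose z m s := invmx (P (sigma (t m))) *m map_mx (real_complex R) (x s).
have cx := solution_continuous sig sol; have dx := solution_derive sig sol.
have step m : cvnorm (z m.+1 (t m.+1)) <= rho * cvnorm (z m (t m)).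
  have [i [ei /andP[ai bi]]] := st m.
  have [Pu _ AJ] := PJ (sigma (t m)).
  have [e1 e2] : (e i).1 = sigma (t m) /\ (e i).2 = sigma (t m.+1) by rewrite ei.
  have -> : z m.+1 (t m.+1) = Q i *m z m (t m.+1).
    by rewrite /Q /z e1 e2 mulmxA -(mulmxA _ (P _)) mulmxV // mulmx1.
  have [eta0 _] := etaP i.
  have tm : t m <= t m.+1 <= t m.+1 by rewrite lexx ltW.
  have := flow_cvnorm_le Pu AJ (cx m) (dx m) (Q i) (ltW eta0) tm.
  move/le_trans; apply; apply: ler_wpM2r; first exact: cvnorm_ge0.
  apply: le_trans (rhoP i); rewrite -e1.
  by have [_] := dP i; apply; rewrite ltr_distl; apply/andP; split; lra.
have iter m : cvnorm (z m (t m)) <= rho ^+ m * cvnorm (z 0%N 0).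
  elim: m => [|m IH]; first by rewrite expr0 mul1r t0.
  apply: le_trans (step m) _; rewrite exprS -mulrA ler_wpM2l //.
  by case/andP: rho01 => /ltW.
have [m /andP[ms sm]] := signal_locate sig s0.
have [Pu _ AJ] := PJ (sigma (t m)).
(* The time elapsed since the last switch need not lie in a window, but it is at most [B], so growth
   is bounded by a constant. *)
have zs : entnorm (z m s) <= n%:R * expR (B * K) * (n%:R * cvnorm (z m (t m))).
  have sm' : t m <= s <= t m.+1 by rewrite ms ltW.
  apply: le_trans (flow_entnorm_le Pu AJ (cx m) (dx m) sm') _.
  apply: ler_pM; rewrite ?mulr_ge0 ?expR_ge0 ?entnorm_ge0 //; last first.
    exact: entnorm_le_cvnorm.
  apply: ler_wpM2l => //; rewrite ler_expR; apply: ler_pM.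
  - by rewrite subr_ge0.
  - exact: entnorm_ge0.
  - by have [i [_ /andP[_ bi]]] := st m; have := bB i; lra.
  - exact: le_sum.
have xs : rvnorm (x s) <= p * entnorm (z m s).
  rewrite -cvnorm_real -[map_mx _ _](mulKVmx Pu).
  apply: le_trans (cvnorm_le_entnorm _) _; apply: le_trans (entnorm_mul _ _) _.
  by apply: ler_wpM2r; [exact: entnorm_ge0|exact: le_sum].
have z0 : cvnorm (z 0%N 0) <= p' * n%:R * rvnorm (x 0).
  apply: le_trans (cvnorm_mul_le_entnorm _ _) _; rewrite cvnorm_real.
  apply: ler_wpM2r; first exact: sqrtr_ge0.
  by apply: ler_wpM2r => //; exact: (le_sum (fun r => invmx (P r))).
have decay : rho ^+ m <= expR (- ln rho) * expR (- (- ln rho / B * s)).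
  apply: exp_decay => //; apply: le_trans (signal_time_le sig m.+1 bB); exact: ltW.
have rho0 : 0 <= rho ^+ m by case/andP: rho01 => /ltW r0 _; rewrite exprn_ge0.
have x00 : 0 <= rvnorm (x 0) by exact: sqrtr_ge0.
have main : rvnorm (x s) <= c * rho ^+ m * rvnorm (x 0).
  apply: le_trans xs _.
  have -> : c * rho ^+ m * rvnorm (x 0) = p * (n%:R * expR (B * K) *
      (n%:R * (rho ^+ m * (p' * n%:R * rvnorm (x 0))))) by rewrite /c; ring.
  apply: ler_wpM2l => //; apply: le_trans zs _.
  apply: ler_wpM2l; first by rewrite mulr_ge0 ?expR_ge0.
  apply: ler_wpM2l => //; apply: le_trans (iter m) _.
  exact: ler_wpM2l.
apply: le_trans main _; apply: ler_wpM2r => //.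
rewrite -mulrA; apply: ler_pM => //.
by rewrite lerDl.
Qed.
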